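(* Let $a(t)\in\mathbf{U}$ be such that $1\prec a(t)\prec t$, i.e. $\lim_{t\to\infty}|a(t)|=\infty$ and $\lim_{t\to\infty}a(t)/t=0$. Let $W(t)\in\mathbf{E}$ be such that $w(t):=W'(t)$ is positive and non-increasing and $\lim_{t\to\infty}W(t)=\infty$. Suppose that there exists $c>0$ such that $W(t)\le|a(t)|^c$ for all large enough $t$. Let $T_1,\dots,T_k$ be measurable transformations of a probability space $(X,\mathcal{B},\mu)$ such that for each $i=1,\dots,k$ there is a $T_i$-invariant probability measure $\mu_i$ equivalent to $\mu$. If $T_1,\dots,T_k$ are pointwise jointly ergodic, then for any bounded measurable functions $f_1,\dots,f_k$ on $X$, $$\lim_{N\to\infty}\frac{1}{W(N)}\sum_{n=1}^N w(n)\prod_{i=1}^k f_i(T_i^{\lfloor a(n)\rfloor}x)=\prod_{i=1}^k\int f_i\,d\mu_i\quad\text{for a.e. }x.$$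
   Context: Let $\mathbf{B}$ be the ring of germs at $+\infty$ of continuous real functions on $\mathbb{R}$. A Hardy field is a subfield of $\mathbf{B}$ closed under differentiation. $\mathbf{U}$ denotes the union of all Hardy fields. A Hardy field is maximal if it is not a proper subfield of a larger Hardy field; $\mathbf{E}$ denotes the intersection of all maximal Hardy fields. Since these are germs, properties such as positivity and monotonicity are understood for all sufficiently large arguments, and finitely many values of $n$ are irrelevant. $T_1,\dots,T_k$ (with invariant probability measures $\mu_i$ equivalent to $\mu$) are pointwise jointly ergodic if for any bounded measurable functions $f_1,\dots,f_k$ on $X$, $$\lim_{N\to\infty}\frac1N\sum_{n=1}^N\prod_{i=1}^k f_i(T_i^nx)=\prod_{i=1}^k\int f_i\,d\mu_i\quad\text{for a.e. }x.$$ If $a$ is eventually negative, the $T_i$ are understood to be invertible, so that $T_i^{\lfloor a(n)\rfloor}$ makes sense.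
   Formalization: For eventually negative a, besides invertibility of the T_i, the formal theorem also assumes that the inverses of T_1,…,T_k are pointwise jointly ergodic (with the same μ_i); without this the claim is false, e.g. for a(t) = −√t and k = 2. *)

(* Defs.v *)
From HB Require Import structures.
From mathcomp Require Import all_boot all_order all_algebra.
From mathcomp Require Import all_classical all_reals all_analysis.
Import Order.TTheory GRing.Theory Num.Theory.
Import numFieldNormedType.Exports.

Set Implicit Arguments.
Unset Strict Implicit.
Unset Printing Implicit Defensive.

Local Open Scope classical_set_scope.
Local Open Scope ring_scope.

(* A germ at +oo is represented by any of its representatives [R -> R], and a
   set of germs by the set of all representatives of its elements, i.e., by a
   set of functions that is saturated for [eq_germ]. *)
Definition eq_germ (R : realType) (f g : R -> R) : Prop :=
  \forall t \near +oo, f t = g t.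

Definition continuous_germ (R : realType) (f : R -> R) : Prop :=
  exists g : R -> R, continuous g /\ eq_germ f g.

(* The derivative of a germ is the germ of [derive1 f], whose (junk) values at
   points where [f] is not derivable do not matter, provided that [f] is
   eventually derivable. *)
Record hardy_field (R : realType) (H : set (R -> R)) : Prop := HardyField {
  hardy_cont : forall f, H f -> continuous_germ f;
  hardy_germ : forall f g, H f -> eq_germ f g -> H g;
  hardy1 : H (fun=> 1);
  hardyB : forall f g, H f -> H g -> H (fun t => f t - g t);
  hardyM : forall f g, H f -> H g -> H (fun t => f t * g t);
  hardyV : forall f, H f -> ~ eq_germ f (fun=> 0) ->
    exists2 g, H g & eq_germ (fun t => f t * g t) (fun=> 1);
  hardy_derivable : forall f, H f -> \forall t \near +oo, derivable f t 1;
  hardy_deriv : forall f, H f -> H (derive1 f)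
}.

Definition maximal_hardy_field (R : realType) (H : set (R -> R)) : Prop :=
  hardy_field H /\ forall K, hardy_field K -> H `<=` K -> K = H.

Definition hardyU (R : realType) : set (R -> R) :=
  [set f | exists2 H, hardy_field H & H f].

Definition hardyE (R : realType) : set (R -> R) :=
  [set f | forall H, maximal_hardy_field H -> H f].

Definition inv_map (X : Type) (T : X -> X) : X -> X :=
  'pinv_id [set: X] T.

Definition invertible d (X : measurableType d) (T : X -> X) : Prop :=
  bijective T /\ measurable_fun [set: X] (inv_map T).

(* [T^m] for an integer [m]; for [m < 0] it is only meaningful when [T] is
   invertible. *)
Definition iterz (X : Type) (T : X -> X) (m : int) : X -> X :=
  match m with
  | Posz n => iter n T
  | Negz n => iter n.+1 (inv_map T)
  end.

Definition equivalent_measures d (X : measurableType d) (R : realType)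
    (P Q : probability X R) : Prop :=
  P `<< Q /\ Q `<< P.

Definition invariant_measure d (X : measurableType d) (R : realType)
    (T : X -> X) (P : probability X R) : Prop :=
  forall A, measurable A -> P (T @^-1` A) = P A.

Definition pointwise_jointly_ergodic d (X : measurableType d) (R : realType)
    (mu : probability X R) (k : nat) (T : 'I_k -> X -> X)
    (nu : 'I_k -> probability X R) : Prop :=
  forall f : 'I_k -> X -> R,
    (forall i, measurable_fun [set: X] (f i)) ->
    (forall i, [bounded f i x | x in [set: X]]) ->
    {ae mu, forall x,
      N%:R^-1 * (\sum_(1 <= n < N.+1) \prod_(i < k) f i (iter n (T i) x))
        @[N --> \oo] -->
      \prod_(i < k) (\int[nu i]_(y in [set: X]) f i y)%R}.

(* Main.v *)
Require Import Defs.
From HB Require Import structures.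
From mathcomp Require Import all_boot all_order all_algebra.
From mathcomp Require Import all_classical all_reals all_analysis.
From mathcomp Require Import ring lra.
Import Order.TTheory GRing.Theory Num.Theory.
Import numFieldNormedType.Exports.

(* For almost every x the sequence b j = \prod_i f_i (T_i^j x) is bounded and has
   Cesaro mean L = \prod_i \int f_i, and the rest is deterministic.  Let A be the
   primitive of the step function t |-> b (floor t) - L, so that A t = o(t).  Since a'
   is small, w n * (b (floor (a n)) - L) is close to the increment of A o a at n
   multiplied by r n, where r = w / a', and summation by parts reduces the claim to
   r a + \sum |r (n+1) - r n| a (n+1) = O(W).  All functions involved lie in one maximal
   Hardy field, as W belongs to each of them; hence r is eventually monotone, and
   W <= |a|^c forces a W' = O(a' W), that is, r a = O(W).  If a is eventually
   negative, the argument applies to - a and the inverse maps, with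
   floor (- x) = - (j + 1) for j < x <= j + 1. *)

Set Implicit Arguments.
Unset Strict Implicit.
Unset Printing Implicit Defensive.

Local Open Scope classical_set_scope.
Local Open Scope ring_scope.

(** This is [S = o(Z)] when [Z] tends to infinity. The free constant [C] absorbs bounded errors and
    finitely many terms, so no starting index has to be tracked. *)
Definition negligible_to {R : realType} (Z S : nat -> R) : Prop :=
  forall e : R, 0 < e -> exists C, forall N, `|S N| <= e * Z N + C.

(** * Calculus of negligible sequences *)

Section Negligible.
Context {R : realType}.
Implicit Types (Z S Y u x : nat -> R).

Lemma negligible_to_le Z S S' :
  (forall N, `|S N| <= `|S' N|) -> negligible_to Z S' -> negligible_to Z S.
Proof.
move=> SS' S'Z e /S'Z[C hC]; exists C => N; exact: le_trans (SS' N) (hC N).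
Qed.

Lemma negligible_to_eq Z S S' :
  S =1 S' -> negligible_to Z S' -> negligible_to Z S.
Proof. by move=> SS'; apply: negligible_to_le => N; rewrite SS'. Qed.

Lemma negligible_toD Z S S' : negligible_to Z S -> negligible_to Z S' ->
  negligible_to Z (fun N => S N + S' N).
Proof.
move=> SZ S'Z e e0.
have e20 : 0 < e / 2 by rewrite divr_gt0.
have [C hC] := SZ _ e20; have [C' hC'] := S'Z _ e20.
exists (C + C') => N; apply: le_trans (ler_normD _ _) _.
have := hC N; have := hC' N; lra.
Qed.

Lemma negligible_toZ Z S c : negligible_to Z S ->
  negligible_to Z (fun N => c * S N).
Proof.
move=> SZ e e0.
have c0 : 0 < `|c| + 1 by rewrite ltr_wpDl.
have [C hC] := SZ _ (divr_gt0 e0 c0).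
exists ((`|c| + 1) * C) => N; rewrite normrM.
apply: le_trans (_ : (`|c| + 1) * `|S N| <= _).
  by rewrite ler_wpM2r ?normr_ge0// lerDl.
apply: le_trans (ler_wpM2l (ltW c0) (hC N)) _.
by rewrite mulrDr mulrA mulrCA mulfV ?gt_eqF// mulr1.
Qed.

Lemma negligible_to_bounded Z S C : (forall N, 0 <= Z N) ->
  (forall N, `|S N| <= C) -> negligible_to Z S.
Proof.
move=> Z0 SC e e0; exists C => N; apply: le_trans (SC N) _.
by rewrite lerDr mulr_ge0// ltW.
Qed.

Lemma negligible_to_trans Y Z S K K' : 0 < K -> (forall N, Y N <= K * Z N + K') ->
  negligible_to Y S -> negligible_to Z S.
Proof.
move=> K0 YZ SY e e0; have eK0 : 0 < e / K by rewrite divr_gt0.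
have [C hC] := SY _ eK0; exists (e / K * K' + C) => N.
apply: le_trans (hC N) _; rewrite addrA lerD2r.
apply: le_trans (ler_wpM2l (ltW eK0) (YZ N)) _.
by rewrite mulrDr mulrA mulfVK// gt_eqF.
Qed.


Lemma negligible_to_mul_cvg0 Z x : (forall N, 0 <= Z N) ->
  x N @[N --> \oo] --> 0 -> negligible_to Z (fun N => x N * Z N).
Proof.
move=> Z0 /cvgrPdist_le x0 e e0; have [n1 _ hn1] := x0 _ e0.
exists (\sum_(n < n1) `|x n * Z n|) => N.
have [n1N|Nn1] := leqP n1 N; last first.
  by rewrite (bigD1 (Ordinal Nn1))//= addrCA lerDl addr_ge0 ?sumr_ge0// mulr_ge0// ltW.
rewrite -[leLHS]addr0 lerD ?sumr_ge0// normrM (ger0_norm (Z0 N)) ler_wpM2r//.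
by have := hn1 _ n1N; rewrite /= sub0r normrN.
Qed.

(** A Toeplitz argument: from some [n1] on each term is at most [e * u n], and the finitely many
    earlier terms go into the constant. *)
Lemma negligible_to_sum u x : (forall n, 0 <= u n) ->
  x n @[n --> \oo] --> 0 ->
  negligible_to (fun N => \sum_(n < N) u n) (fun N => \sum_(n < N) x n * u n).
Proof.
move=> u0 /cvgrPdist_le x0 e e0; have [n1 _ hn1] := x0 _ e0.
exists (\sum_(n < n1) `|x n * u n|) => N.
apply: le_trans (ler_norm_sum _ _ _) _.
have le_term n :
    `|x n * u n| <= e * u n + (if (n < n1)%N then `|x n * u n| else 0).
  case: ltnP => nn1; first by rewrite lerDr mulr_ge0// ltW.
  rewrite addr0 normrM (ger0_norm (u0 n)) ler_wpM2r//.
  by have := hn1 _ nn1; rewrite /= sub0r normrN.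
pose F n := e * u n + (if (n < n1)%N then `|x n * u n| else 0).
apply: (@le_trans _ _ (\sum_(n < N) F n)); first exact: ler_sum.
rewrite big_split/= -mulr_sumr lerD2l.
have [Nn1|n1N] := leqP N n1.
  rewrite [leLHS](_ : _ = \sum_(n < N) `|x n * u n|); last first.
    by apply: eq_bigr => i _; rewrite (leq_trans (ltn_ord i) Nn1).
  rewrite -!(big_mkord xpredT (fun n => `|x n * u n|)).
  by rewrite [leRHS](big_cat_nat (leq0n N) Nn1)//= lerDl sumr_ge0.
rewrite -(big_mkord xpredT (fun n => if (n < n1)%N then `|x n * u n| else 0)).
rewrite (big_cat_nat (leq0n n1) (ltnW n1N))//= [X in _ + X]big_nat_cond.
rewrite [X in _ + X]big1 ?addr0; last first.
  by move=> i /andP[/andP[n1i _] _]; rewrite ltnNge n1i.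
rewrite big_nat [leLHS](_ : _ = \sum_(0 <= i < n1) `|x i * u i|).
  by rewrite big_mkord.
by rewrite [RHS]big_nat; apply: eq_bigr => i /andP[_ ->].
Qed.

(** The way back to limits. The slack between [Z] and [V] is there because a sum of values of W'
    agrees with W only up to a bounded error. *)
Lemma negligible_to_cvg0 Z S V : negligible_to Z S ->
  (exists C, forall N, Z N <= V N + C) ->
  V N @[N --> \oo] --> +oo -> S N / V N @[N --> \oo] --> 0.
Proof.
move=> SZ [C ZV] Voo; apply/cvgrPdist_le => e e0.
have e20 : 0 < e / 2 by rewrite divr_gt0.
have [C' hC'] := SZ _ e20.
(* Beyond this threshold [e / 2 * V N] dominates the constants [e / 2 * C + C']; the other half of
   [e] pays for [Z N]. *)
have hV := (cvgryPge _).1 Voo (Num.max 1 ((e / 2 * C + C') / (e / 2))).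
near=> N.
have : Num.max 1 ((e / 2 * C + C') / (e / 2)) <= V N by near: N; exact: hV.
rewrite ge_max => /andP[V1]; rewrite ler_pdivrMr// => VC.
have V0 : 0 < V N by rewrite (lt_le_trans _ V1).
rewrite sub0r normrN normrM normfV (gtr0_norm V0) ler_pdivrMr//.
apply: le_trans (hC' N) _.
have := ler_wpM2l (ltW e20) (ZV N); lra.
Unshelve. all: by end_near. Qed.

End Negligible.

(** * Deterministic weighted Cesaro means along a slowly growing sequence *)

Section WeightedCesaro.
Context {R : realType}.
(** Model of the values of W', a and W' / a' at consecutive integers. As a' is non-increasing, [d n]
    lies between its values at n+1 and n, which gives [rd_ge] and [rd_le]; [ra_le] expresses r a =
    O(W). *)
Variables (w a r : nat -> R) (C : R).

Local Notation Z := (fun N => \sum_(n < N) w n).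
Local Notation d n := (a n.+1 - a n).
Local Notation dr n := (r n.+1 - r n).

Hypothesis w_ge0 : forall n, 0 <= w n.
Hypothesis w_noninc : forall n, w n.+1 <= w n.
Hypothesis a_ge1 : forall n, 1 <= a n.
Hypothesis d_ge0 : forall n, 0 <= d n.
Hypothesis d_lt1 : forall n, d n < 1.
Hypothesis d_cvg0 : d n @[n --> \oo] --> 0.
Hypothesis a_cvgy : a n @[n --> \oo] --> +oo.
Hypothesis r_ge0 : forall n, 0 <= r n.
Hypothesis r_mono : (forall n, r n <= r n.+1) \/ (forall n, r n.+1 <= r n).
Hypothesis rd_le : forall n, r n * d n <= w n.
Hypothesis rd_ge : forall n, w n.+1 <= r n.+1 * d n.
Hypothesis C_gt0 : 0 < C.
Hypothesis ra_le : forall n, r n * a n <= C * (Z n + 1).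

Let Z_ge0 N : 0 <= Z N.
Proof. exact: sumr_ge0. Qed.

Let a_gt0 n : 0 < a n.
Proof. exact: lt_le_trans ltr01 (a_ge1 n). Qed.

Let a_nd n : a n <= a n.+1.
Proof. by rewrite -subr_ge0. Qed.

(** Summation by parts. If [r] increases, the sum is at most the boundary term [r N * a N],
    controlled by [ra_le]; if [r] decreases, it is at most [r 0 * a 0] plus the sum of [r n * d n],
    controlled by [rd_le]. *)
Lemma variation_bound : exists K K' : R, 0 < K /\
  forall N, \sum_(n < N) `|dr n| * a n.+1 <= K * Z N + K'.
Proof.
case: r_mono => [r_nd|r_ni].
  exists C, C; split=> // N.
  apply: (@le_trans _ _ (r N * a N)); last by have := ra_le N; rewrite mulrDr mulr1.
  elim: N => [|N IH]; first by rewrite big_ord0 mulr_ge0// ltW.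
  rewrite big_ord_recr/= ger0_norm ?subr_ge0//.
  apply: (@le_trans _ _ (r N * a N + dr N * a N.+1)); first by rewrite lerD2r.
  have := ler_wpM2l (r_ge0 N) (a_nd N); lra.
exists 1, (r 0 * a 0); split=> // N; rewrite mul1r.
apply: (@le_trans _ _ (Z N + r 0 * a 0 - r N * a N)); last first.
  by rewrite gerBl mulr_ge0// ltW.
elim: N => [|N IH]; first by rewrite !big_ord0 add0r subrr.
rewrite !big_ord_recr/= ler0_norm ?subr_le0//.
have := rd_le N; lra.
Qed.

Let negligible_variation (x : nat -> R) : x n @[n --> \oo] --> 0 ->
  negligible_to Z (fun N => \sum_(n < N) x n * (`|dr n| * a n.+1)).
Proof.
move=> x0; have [K [K' [K0 hK]]] := variation_bound.
apply: (negligible_to_trans K0 hK); 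
  apply: (@negligible_to_sum _ (fun n => `|dr n| * a n.+1) x) => // n.
by rewrite mulr_ge0// ltW.
Qed.

Let da_cvg0 : d n / a n.+1 @[n --> \oo] --> 0.
Proof.
apply/cvgrPdist_le => e e0; have /cvgrPdist_le/(_ _ e0) small_d := d_cvg0.
near=> n.
rewrite sub0r normrN ger0_norm ?divr_ge0//; last by rewrite ltW.
apply: (@le_trans _ _ (d n)).
  by rewrite ler_pdivrMr// ler_peMr.
have : `|0 - d n| <= e by near: n; exact: small_d.
by rewrite sub0r normrN ger0_norm.
Unshelve. all: by end_near. Qed.

(** The defect is nonnegative and at most [(w n - w n.+1) + |dr n| * d n]. The first part
    telescopes; the second is a vanishing multiple of the summand in [variation_bound]. *)
Let negligible_defect :
  negligible_to Z (fun N => \sum_(n < N) (w n - r n * d n)).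
Proof.
have term n : w n - r n * d n <= (w n - w n.+1) + `|dr n| * d n.
  have := rd_ge n; have := ler_wpM2r (d_ge0 n) (ler_norm (dr n)); lra.
apply: (@negligible_to_le _ _ _
  (fun N => w 0 + \sum_(n < N) (d n / a n.+1) * (`|dr n| * a n.+1))).
  move=> N; rewrite [leLHS]ger0_norm ?sumr_ge0//; last first.
    by move=> n _; rewrite subr_ge0.
  apply: le_trans (ler_norm _).
  apply: (@le_trans _ _ (w 0 - w N + \sum_(n < N) `|dr n| * d n)).
    elim: N => [|N IH]; first by rewrite !big_ord0 subrr addr0.
    rewrite !big_ord_recr/=; have := term N; lra.
  rewrite lerD ?gerBl// le_eqVlt; apply/orP; left; apply/eqP.
  apply: eq_bigr => n _; rewrite mulrCA mulfVK ?gt_eqF//.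
apply: negligible_toD; first exact: (@negligible_to_bounded _ _ _ `|w 0|).
exact: negligible_variation da_cvg0.
Qed.

(** [m n] is an integer part of [a n]. Both bounds are non-strict, so that it may also be the
    greatest integer strictly below [a n], as occurs for negative functions. *)
Variables (b : nat -> R) (m : nat -> nat) (M : R).
Hypothesis m_nd : forall n, (m n <= m n.+1)%N.
Hypothesis m_le : forall n, (m n)%:R <= a n.
Hypothesis m_ge : forall n, a n <= (m n).+1%:R.
Hypothesis b_le : forall j, `|b j| <= M.
Hypothesis b_mean : negligible_to (fun j => j%:R : R) (fun N => \sum_(j < N) b j).

Local Notation dm n := ((m n.+1)%:R - (m n)%:R : R).

Let dm_ge0 n : 0 <= dm n.
Proof. by rewrite subr_ge0 ler_nat. Qed.

Let M_ge0 : 0 <= M.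
Proof. exact: le_trans (b_le 0). Qed.

(** [dm n] and [d n] differ by an increment of the fractional part [a n - m n], which stays in
    [0, 1]; against the non-increasing weight these increments contribute at most [w 0]. What
    remains has the factor [d n], which tends to 0. *)
Let negligible_jumps : negligible_to Z (fun N => \sum_(n < N) w n * dm n).
Proof.
apply: (@negligible_to_le _ _ _ (fun N => w 0 + \sum_(n < N) d n * w n)).
  move=> N; rewrite [leLHS]ger0_norm ?sumr_ge0//; last first.
    by move=> n _; rewrite mulr_ge0.
  apply: le_trans (ler_norm _).
  have e_ge0 n : 0 <= a n - (m n)%:R by rewrite subr_ge0.
  apply: (@le_trans _ _
      (w 0 + \sum_(n < N) d n * w n - w N * (a N - (m N)%:R))); last first.
    by rewrite gerBl mulr_ge0.
  elim: N => [|N IH].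
    rewrite !big_ord0 addr0 subr_ge0 ler_piMr// lerBlDr.
    by have := m_ge 0; rewrite -natr1 addrC.
  rewrite !big_ord_recr/=; have := ler_wpM2r (e_ge0 N.+1) (w_noninc N); lra.
apply: negligible_toD; first exact: (@negligible_to_bounded _ _ _ `|w 0|).
exact: (@negligible_to_sum _ w (fun n => d n)).
Qed.

(* The integral over [0, a n] of the step function t |-> b (floor t). *)
Let F n := \sum_(j < m n) b j + (a n - (m n)%:R) * b (m n).

(** As [d n < 1], the integer part jumps by 0 or 1. Without a jump the two sides agree exactly; with
    one, [b] takes the wrong value only on the piece beyond [m n.+1], of length at most [d n]. *)
Let F_increment n : `|d n * b (m n) - (F n.+1 - F n)| <= 2 * M * (d n * dm n).
Proof.
have := m_nd n; rewrite leq_eqVlt => /orP[/eqP e|].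
  rewrite /F -e subrr !mulr0 [X in `|X|](_ : _ = 0) ?normr0//; ring.
rewrite leq_eqVlt => /orP[/eqP e|lt2].
  have E : d n * b (m n) - (F n.+1 - F n) =
      (a n.+1 - (m n.+1)%:R) * (b (m n) - b (m n.+1)).
    rewrite /F -e big_ord_recr/= -natr1; ring.
  have -> : dm n = 1 by rewrite -e -natr1; lra.
  rewrite E mulr1 normrM ger0_norm ?subr_ge0// mulrC ler_pM ?subr_ge0//.
    apply: le_trans (ler_normB _ _) _.
    by have := b_le (m n); have := b_le (m n.+1); lra.
  by rewrite lerB// -e.
exfalso; have := d_lt1 n; rewrite ltNge => /negP; apply.
have : (m n).+2%:R <= (m n.+1)%:R :> R by rewrite ler_nat.
have := m_le n.+1; have := m_ge n; rewrite -!natr1; lra.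
Qed.

Let F_cvg0 : F n / a n @[n --> \oo] --> 0.
Proof.
apply/cvgrPdist_le => e e0.
have e20 : 0 < e / 2 by rewrite divr_gt0.
have [K hK] := b_mean e20.
near=> n; rewrite sub0r normrN normrM normfV [`|a n|]gtr0_norm// ler_pdivrMr//.
apply: le_trans (ler_normD _ _) _; rewrite normrM.
have h1 := hK (m n); have h2 := ler_wpM2l (ltW e20) (m_le n).
have h3 : `|a n - (m n)%:R| * `|b (m n)| <= M.
  rewrite -[leRHS]mul1r ler_pM// ger0_norm ?subr_ge0//.
  by have := m_ge n; rewrite -natr1; lra.
have : (K + M) / (e / 2) <= a n by near: n; exact: (cvgryPge _).1.
rewrite ler_pdivrMr//; lra.
Unshelve. all: by end_near. Qed.

(** Summation by parts moves the difference onto [r]. As F = o(a), the boundary term is a vanishing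
    multiple of [r N * a N], and the remaining sum is governed by [variation_bound]. *)
Let negligible_main : negligible_to Z (fun N => \sum_(n < N) r n * (F n.+1 - F n)).
Proof.
apply: (@negligible_to_eq _ _ _ (fun N => (r N * F N - r 0 * F 0)
   + -1 * \sum_(n < N) dr n * F n.+1)).
  move=> N; elim: N => [|N IH]; first by rewrite !big_ord0; ring.
  by rewrite !big_ord_recr/= IH; ring.
apply: negligible_toD; last first.
  apply: (@negligible_toZ _ _ (fun N => \sum_(n < N) dr n * F n.+1)).
  apply: (@negligible_to_le _ _ _
     (fun N => \sum_(n < N) `|F n.+1 / a n.+1| * (`|dr n| * a n.+1))).
    move=> N; apply: le_trans (ler_norm_sum _ _ _) _; apply: le_trans (ler_norm _).
    apply: ler_sum => n _; rewrite !normrM normfV [`|a _|]gtr0_norm//.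
    by rewrite mulrACA mulVf ?gt_eqF// mulr1 mulrC.
  apply: (@negligible_variation (fun n => `|F n.+1 / a n.+1|)); rewrite -(normr0 R); apply: cvg_norm.
  by rewrite (cvg_shiftS (fun n => F n / a n)).
apply: negligible_toD; last exact: (@negligible_to_bounded _ _ _ `|- (r 0 * F 0)|).
have ZC N : C * (Z N + 1) <= C * Z N + C by rewrite mulrDr mulr1.
apply: (@negligible_to_trans _ (fun N => r N * a N) _ _ C C) => //.
  by move=> N; rewrite (le_trans (ra_le N)).
apply: (@negligible_to_eq _ _ _ (fun N => F N / a N * (r N * a N))).
  by move=> N; rewrite [r N * a N]mulrC mulrA mulfVK ?gt_eqF// mulrC.
by apply: negligible_to_mul_cvg0 => // n; rewrite mulr_ge0// ltW.
Qed.

Theorem weighted_cesaro_mean0 :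
  negligible_to Z (fun N => \sum_(n < N) w n * b (m n)).
Proof.
(* Three errors: replacing [w] by [r * d], replacing [d * b] by the increment of [F], and the sum of
   [r] against these increments. In the second, [rd_le] turns [r n * d n * dm n] into
   [w n * dm n]. *)
apply: (@negligible_to_eq _ _ _ (fun N =>
   \sum_(n < N) (w n - r n * d n) * b (m n) +
   (\sum_(n < N) r n * (d n * b (m n) - (F n.+1 - F n)) +
    \sum_(n < N) r n * (F n.+1 - F n)))).
  by move=> N; rewrite -!big_split/=; apply: eq_bigr => n _; ring.
apply: negligible_toD.
  apply: (negligible_to_le _ (negligible_toZ M negligible_defect)) => N.
  apply: le_trans (ler_norm_sum _ _ _) _; apply: le_trans (ler_norm _).
  rewrite mulr_sumr; apply: ler_sum => n _.
  rewrite normrM ger0_norm ?subr_ge0// mulrC ler_wpM2r// subr_ge0//.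
apply: negligible_toD; last exact: negligible_main.
apply: (negligible_to_le _ (negligible_toZ (2 * M) negligible_jumps)) => N.
apply: le_trans (ler_norm_sum _ _ _) _; apply: le_trans (ler_norm _).
rewrite mulr_sumr; apply: ler_sum => n _.
rewrite normrM ger0_norm//.
apply: le_trans (ler_wpM2l (r_ge0 n) (F_increment n)) _.
rewrite mulrCA ler_wpM2l ?mulr_ge0// mulrA ler_wpM2r//.
Qed.

End WeightedCesaro.

(** * Differentiable functions near infinity *)

Section NearInfinity.
Context {R : realType}.
Implicit Types (f : R -> R) (P : R -> Prop).

Lemma near_pinftyP P :
  (\forall t \near +oo, P t) <-> exists A, forall t, A <= t -> P t.
Proof.
split=> [[A [_ hA]]|[A hA]].
  by exists (A + 1) => t At; apply: hA; rewrite (lt_le_trans _ At)// ltrDl.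
by exists A; split=> [|t /ltW]; [exact: num_real|exact: hA].
Qed.

Lemma near_forall_ge (P : R -> R -> Prop) :
  (exists A, forall s t, A <= s -> s <= t -> P s t) ->
  \forall s \near +oo, forall t, s <= t -> P s t.
Proof. by move=> [A hA]; apply/near_pinftyP; exists A => s As t; exact: hA. Qed.

Lemma near_MVT f : (\forall t \near +oo, derivable f t 1) ->
  exists A, forall s t, A <= s -> s <= t ->
    exists2 c, s <= c <= t & f t - f s = derive1 f c * (t - s).
Proof.
move=> /near_pinftyP[A df]; exists A => s t As st.
have dft x : s <= x -> derivable f x 1 by move=> sx; apply: df; exact: le_trans sx.
have [x| |c] := @MVT_segment _ f (derive1 f) s t st.
- rewrite in_itv/= => /andP[/ltW sx _].
  by rewrite derive1E; apply: derivableP; exact: dft.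
- apply: derivable_within_continuous => x.
  by rewrite in_itv/= => /andP[sx _]; exact: dft.
- by rewrite in_itv/= => cst ->; exists c.
Qed.

Lemma near_nondecreasing f : (\forall t \near +oo, derivable f t 1) ->
  (\forall t \near +oo, 0 <= derive1 f t) ->
  exists A, forall s t, A <= s -> s <= t -> f s <= f t.
Proof.
move=> /near_MVT[A hA] /near_pinftyP[B hB]; exists (Num.max A B) => s t.
rewrite ge_max => /andP[As Bs] st; have [c /andP[sc _] E] := hA _ _ As st.
by rewrite -subr_ge0 E mulr_ge0 ?subr_ge0//; apply: hB; exact: le_trans sc.
Qed.

Lemma near_nonincreasing f : (\forall t \near +oo, derivable f t 1) ->
  (\forall t \near +oo, derive1 f t <= 0) ->
  exists A, forall s t, A <= s -> s <= t -> f t <= f s.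
Proof.
move=> /near_MVT[A hA] /near_pinftyP[B hB]; exists (Num.max A B) => s t.
rewrite ge_max => /andP[As Bs] st; have [c /andP[sc _] E] := hA _ _ As st.
rewrite -subr_le0 E mulr_le0_ge0 ?subr_ge0//; apply: hB; exact: le_trans sc.
Qed.

Lemma sublinear_derive1 f e : (\forall t \near +oo, derivable f t 1) ->
  f t / t @[t --> +oo] --> 0 -> 0 < e -> ~ \forall t \near +oo, e <= derive1 f t.
Proof.
move=> /near_MVT[A hA] f0 e0 /near_pinftyP[B hB].
have e20 : 0 < e / 2 by rewrite divr_gt0.
have /cvgrPdist_le/(_ _ e20)/near_pinftyP[D hD] := f0.
pose s := Num.max A (Num.max B 1).
have As : A <= s by rewrite le_max lexx.
have Bs : B <= s by rewrite !le_max lexx orbT.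
(* Slope at least [e] after [s], together with [f t <= e / 2 * t], forces
   [e / 2 * t <= e * s - f s]; this [t] is too large for that. *)
pose t := Num.max (Num.max s D) ((e * s - f s) / (e / 2) + 1).
have st : s <= t by rewrite le_max le_max lexx.
have t0 : 0 < t by rewrite (lt_le_trans _ st)// !lt_max ltr01 !orbT.
have [c /andP[sc _] E] := hA _ _ As st.
have le1 : e * (t - s) <= f t - f s.
  by rewrite E ler_wpM2r ?subr_ge0// hB// (le_trans Bs).
have /hD : D <= t by rewrite le_max le_max lexx !orbT.
rewrite sub0r normrN => /(le_trans (ler_norm _)); rewrite ler_pdivrMr// => le2.
have : (e * s - f s) / (e / 2) < t by rewrite lt_max ltrDl ltr01 orbT.
rewrite ltr_pdivrMr//; lra.
Qed.

End NearInfinity.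

(** * Signs, monotonicity and growth in a Hardy field *)

Section HardyField.
Context {R : realType} (H : set (R -> R)).
Hypothesis HH : hardy_field H.
Implicit Types f g : R -> R.

Lemma hardy_eq_fun f g : H f -> (forall t, f t = g t) -> H g.
Proof. by move=> Hf fg; rewrite -(_ : f = g)//; apply/funext. Qed.

Lemma hardy0 : H (fun=> 0).
Proof.
by apply: hardy_eq_fun (hardyB HH (hardy1 HH) (hardy1 HH)) _ => t; rewrite subrr.
Qed.

Lemma hardyN f : H f -> H (fun t => - f t).
Proof.
by move=> Hf; apply: hardy_eq_fun (hardyB HH hardy0 Hf) _ => t; rewrite sub0r.
Qed.

Lemma hardyD f g : H f -> H g -> H (fun t => f t + g t).
Proof.
move=> Hf Hg; apply: hardy_eq_fun (hardyB HH Hf (hardyN Hg)) _ => t.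
by rewrite opprK.
Qed.

Lemma hardy_nat n : H (fun=> n%:R).
Proof.
elim: n => [|n IH]; first exact: hardy0.
by apply: hardy_eq_fun (hardyD IH (hardy1 HH)) _ => t; rewrite natr1.
Qed.

Lemma hardyX f n : H f -> H (fun t => f t ^+ n).
Proof.
move=> Hf; elim: n => [|n IH]; first exact: hardy1.
by apply: hardy_eq_fun (hardyM HH Hf IH) _ => t; rewrite exprS.
Qed.

Lemma hardy_div f g : H f -> H g -> (\forall t \near +oo, g t != 0) ->
  H (fun t => f t / g t).
Proof.
move=> Hf Hg g0; have [g0'|h Hh gh] := hardyV HH Hg.
  have [t [g1 /eqP]] : exists t, g t = 0 /\ g t != 0; last by [].
  have /near_pinftyP[A hA] := g0; have /near_pinftyP[B hB] := g0'.
  exists (Num.max A B); split; first by apply: hB; rewrite le_max lexx orbT.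
  by apply: hA; rewrite le_max lexx.
apply: (hardy_germ HH (hardyM HH Hf Hh)); near=> t.
have gt0 : g t != 0 by near: t.
have : g t * h t = 1 by near: t.
by move=> E; rewrite -[h t](mulKf gt0) E mulr1.
Unshelve. all: by end_near. Qed.

(** A nonzero germ is invertible, hence eventually without zeros, and the intermediate value theorem
    for a continuous representative fixes its sign. *)
Lemma hardy_sign f : H f ->
  [\/ \forall t \near +oo, f t = 0,
      \forall t \near +oo, 0 < f t |
      \forall t \near +oo, f t < 0].
Proof.
move=> Hf; have [f0|nf0] := pselect (eq_germ f (fun=> 0)); first by constructor 1.
have [g _ /near_pinftyP[A hA]] := hardyV HH Hf nf0.
have [h [h_cont /near_pinftyP[B hB]]] := hardy_cont HH Hf.
pose s := Num.max A B.
have fh t : s <= t -> f t = h t.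
  by rewrite ge_max => /andP[_ /hB].
have h0 t : s <= t -> h t != 0.
  move=> st; rewrite -fh//; apply/eqP => ft0.
  have : f t * g t = 1 by apply: hA; move: st; rewrite ge_max => /andP[].
  by rewrite ft0 mul0r => /eqP; rewrite eq_sym oner_eq0.
have no_root t : s <= t ->
    ~ (Num.min (h s) (h t) <= 0 <= Num.max (h s) (h t)).
  move=> st /(IVT st (continuous_subspaceT h_cont))[c].
  by rewrite in_itv/= => /andP[sc _] hc; have := h0 _ sc; rewrite hc eqxx.
have [hs0|hs0] := ltP 0 (h s).
  constructor 2; apply/near_pinftyP; exists s => t st; rewrite fh// ltNge.
  apply/negP => ht; apply: (no_root _ st).
  by rewrite ge_min ht orbT le_max (ltW hs0).
constructor 3; apply/near_pinftyP; exists s => t st; rewrite fh// ltNge.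
apply/negP => ht; apply: (no_root _ st).
by rewrite ge_min hs0 le_max ht orbT.
Qed.

Lemma hardy_monotone f : H f ->
  (exists A, forall s t, A <= s -> s <= t -> f s <= f t) \/
  (exists A, forall s t, A <= s -> s <= t -> f t <= f s).
Proof.
move=> Hf; have df := hardy_derivable HH Hf.
have [f0|f0|f0] := hardy_sign (hardy_deriv HH Hf).
- by left; apply: near_nondecreasing => //; apply: filterS f0 => t ->.
- by left; apply: near_nondecreasing => //; apply: filterS f0 => t /ltW.
- by right; apply: near_nonincreasing => //; apply: filterS f0 => t /ltW.
Qed.

Variables (a W : R -> R).
Hypotheses (Ha : H a) (HW : H W).
Hypothesis a_oo : a t @[t --> +oo] --> +oo.

Lemma hardy_derive1_gt0 : \forall t \near +oo, 0 < derive1 a t.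
Proof.
have no : ~ exists A, forall s t, A <= s -> s <= t -> a t <= a s.
  move=> [A hA]; have /cvgryPge/(_ (a A + 1))/near_pinftyP[B hB] := a_oo.
  have := hA A (Num.max A B); have := hB (Num.max A B).
  rewrite !le_max !lexx orbT => /(_ isT) h1 /(_ isT isT) h2; lra.
have da := hardy_derivable HH Ha.
have [f0|//|f0] := hardy_sign (hardy_deriv HH Ha); exfalso; apply: no.
  by apply: near_nonincreasing => //; apply: filterS f0 => t ->.
by apply: near_nonincreasing => //; apply: filterS f0 => t /ltW.
Qed.

(* If a W' > (k+1) a' W held eventually, then W / a^(k+1) would be eventually
   increasing, hence bounded away from 0, against W <= a^k and a --> +oo. *)
Lemma hardy_logderiv_le k : (\forall t \near +oo, 0 < W t) ->
  (\forall t \near +oo, W t <= a t ^+ k) ->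
  \forall t \near +oo, a t * derive1 W t <= k.+1%:R * (derive1 a t * W t).
Proof.
move=> W_gt0 Wk.
have Hphi := hardyB HH (hardyM HH Ha (hardy_deriv HH HW))
  (hardyM HH (hardy_nat k.+1) (hardyM HH (hardy_deriv HH Ha) HW)).
have [p0|p0|p0] := hardy_sign Hphi.
- by apply: filterS p0 => t /eqP; rewrite subr_eq0 => /eqP ->.
- exfalso.
  have a_gt0 : \forall t \near +oo, 0 < a t by exact: (cvgryPgt _).1.
  have da := hardy_derivable HH Ha; have dW := hardy_derivable HH HW.
  have Hq : H (fun t => W t / a t ^+ k.+1).
    apply: hardy_div (hardyX _ Ha) _ => //.
    by apply: filterS a_gt0 => t a0; rewrite expf_neq0// gt_eqF.
  have [|A q_nd] := near_nondecreasing (hardy_derivable HH Hq).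
    near=> t.
    have [dat dWt] : derivable a t 1 /\ derivable W t 1.
      by near: t; exact: filterI da dW.
    have a0 : 0 < a t by near: t.
    have phi_gt0 : 0 < a t * derive1 W t - k.+1%:R * (derive1 a t * W t) by near: t.
    have /derivableP := dat; rewrite -derive1E => {}dat.
    have /derivableP := dWt; rewrite -derive1E => {}dWt.
    have aX0 : (a ^+ k.+1) t != 0 by rewrite exprfctE expf_neq0// gt_eqF.
    have := is_deriveM dWt (is_deriveV aX0 (is_deriveX k.+1 dat)).
    rewrite exprfctE => /(@derive_val _ _ _ _ _ _ _) => dq.
    rewrite derive1E [X in 0 <= X]dq /GRing.scale/=.
    have ak0 : 0 < a t ^+ k by rewrite exprn_gt0.
    (* The quotient rule for W / a^(k+1): its derivative is the positive quantity of [phi_gt0]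
       divided by a^(k+2). *)
    rewrite (_ : _ + _ = (a t * derive1 W t - k.+1%:R * (derive1 a t * W t)) /
       (a t ^+ k * a t ^+ 2)).
      by rewrite divr_ge0 ?ltW// mulr_gt0// exprn_gt0.
    by rewrite !exprS expr0 mulr1; field; rewrite !gt_eqF.
  have [B [AB Bgt]] : exists B, A <= B /\ 0 < W B / a B ^+ k.+1.
    near (pinfty_nbhs R) => B; exists B; split.
      by near: B; exact: nbhs_pinfty_ge (num_real _).
    by rewrite divr_gt0 ?exprn_gt0//; near: B.
  near (pinfty_nbhs R) => t.
  have a0 : 0 < a t by near: t.
  have Bt : B <= t by near: t; exact: nbhs_pinfty_ge (num_real _).
  (* At such a [t], the bound W <= a^k makes the quotient at most [1 / a t], below its earlier value
     at [B]. *)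
  have : (W B / a B ^+ k.+1)^-1 < a t by near: t; exact: (cvgryPgt _).1.
  rewrite -div1r ltr_pdivrMr// ltNge => /negP; apply.
  rewrite mulrC -ler_pdivlMr//; apply: le_trans (q_nd _ _ AB Bt) _.
  rewrite div1r ler_pdivrMr ?exprn_gt0// exprS mulKf ?gt_eqF//; near: t.
  exact: Wk.
- by apply: filterS p0 => t; rewrite subr_lt0 => /ltW.
Unshelve. all: by end_near. Qed.

Hypothesis a_sublinear : a t / t @[t --> +oo] --> 0.

(** Otherwise a' would be non-decreasing and positive, hence bounded below by a positive constant,
    against sublinearity. *)
Lemma hardy_sublinear_derive1_nonincreasing :
  exists A, forall s t, A <= s -> s <= t -> derive1 a t <= derive1 a s.
Proof.
have da := hardy_derivable HH Ha.
have [[A a'_nd]|//] := hardy_monotone (hardy_deriv HH Ha).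
near (pinfty_nbhs R) => s.
have As : A <= s by near: s; exact: nbhs_pinfty_ge (num_real _).
have a's0 : 0 < derive1 a s by near: s; exact: hardy_derive1_gt0.
exfalso; apply: (sublinear_derive1 da a_sublinear a's0).
by apply/near_pinftyP; exists s => t; exact: a'_nd.
Unshelve. all: by end_near. Qed.

Lemma hardy_sublinear_derive1_cvg0 : derive1 a t @[t --> +oo] --> 0.
Proof.
have da := hardy_derivable HH Ha.
have [A a'_ni] := hardy_sublinear_derive1_nonincreasing.
have /near_pinftyP[B a'_gt0] := hardy_derive1_gt0.
apply/cvgrPdist_lt => e e0.
have [s ABs ltse] : exists2 s, Num.max A B <= s & derive1 a s < e.
  apply: contrapT => no; apply: (sublinear_derive1 da a_sublinear e0).
  apply/near_pinftyP; exists (Num.max A B) => s ABs.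
  by rewrite leNgt; apply/negP => lt; apply: no; exists s.
move: ABs; rewrite ge_max => /andP[As Bs].
apply/near_pinftyP; exists s => t st.
rewrite sub0r normrN gtr0_norm ?a'_gt0 ?(le_trans Bs)//.
exact: le_lt_trans (a'_ni _ _ As st) ltse.
Qed.

(** * Weighted means sampled at the integers *)

Hypothesis w_gt0 : \forall t \near +oo, 0 < derive1 W t.
Hypothesis w_noninc : exists A, forall s t, A <= s -> s <= t ->
  derive1 W t <= derive1 W s.
Hypothesis W_oo : W t @[t --> +oo] --> +oo.
Variable k : nat.
Hypothesis W_le : \forall t \near +oo, W t <= a t ^+ k.

(** The integer part is an abstract [g], so that the same statement serves both signs of the
    original function. *)
Lemma hardy_weighted_mean (b y : nat -> R) (g : R -> nat) (L M : R) :
  (forall x y, 1 <= x -> x <= y -> (g x <= g y)%N) ->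
  (forall x, 1 <= x -> (g x)%:R <= x <= (g x).+1%:R) ->
  (forall j, `|b j| <= M) ->
  negligible_to (fun j => j%:R : R) (fun N => \sum_(j < N) (b j - L)) ->
  (\forall n \near \oo, y n = b (g (a n%:R))) ->
  (W N%:R)^-1 * (\sum_(1 <= n < N.+1) derive1 W n%:R * y n)
    @[N --> \oo] --> L.
Proof.
move=> g_nd g_itv bM b_mean [n1 _ yE].
have da := hardy_derivable HH Ha; have dW := hardy_derivable HH HW.
have a'_gt0 := hardy_derive1_gt0.
pose r t := derive1 W t / derive1 a t.
have Hr : H r.
  apply: hardy_div (hardy_deriv HH HW) (hardy_deriv HH Ha) _.
  by apply: filterS a'_gt0 => t; rewrite lt0r => /andP[].
pose MVT_from (f : R -> R) t := forall u, t <= u ->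
  exists2 c, t <= c <= u & f u - f t = derive1 f c * (u - t).
pose mono_from (f : R -> R) t := forall u, t <= u -> f u <= f t.
have [A r_mono] : exists A, (forall s t, A <= s -> s <= t -> r s <= r t) \/
    (forall s t, A <= s -> s <= t -> r t <= r s).
  by have [[A]|[A]] := hardy_monotone Hr; exists A; [left|right].
have /near_pinftyP[B hB] : \forall t \near +oo,
    [/\ [/\ 1 <= a t, 0 < derive1 a t, derive1 a t < 1, 0 < derive1 W t & 0 < W t],
      a t * derive1 W t <= k.+1%:R * (derive1 a t * W t),
      mono_from (derive1 a) t /\ mono_from (derive1 W) t &
      MVT_from a t /\ MVT_from W t].
  have W_gt0 : \forall t \near +oo, 0 < W t by exact: (cvgryPgt _).1.
  have a_ge1 : \forall t \near +oo, 1 <= a t by exact: (cvgryPge _).1.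
  have a'_lt1 : \forall t \near +oo, derive1 a t < 1.
    exact: cvgr_lt hardy_sublinear_derive1_cvg0 _ ltr01.
  have logder := hardy_logderiv_le W_gt0 W_le.
  have ma := near_forall_ge hardy_sublinear_derive1_nonincreasing.
  have mW := near_forall_ge w_noninc.
  have Ma := near_forall_ge (near_MVT da); have MW := near_forall_ge (near_MVT dW).
  apply: filterS2 (filterI (filterI a_ge1 a'_gt0)
    (filterI a'_lt1 (filterI w_gt0 W_gt0)))
    (filterI logder (filterI (filterI ma mW) (filterI Ma MW))).
  by move=> t [[? ?] [? [? ?]]] [? [? ?]].
(* Sampling starts where all the eventual properties hold and [y] is given by [b]; the successor
   makes [n0] positive, so the sum from 1 can be cut at [n0]. *)
pose n0 := (n1 + Num.bound (Num.max `|A| `|B|)).+1.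
pose s n : R := (n + n0)%:R.
have sS n : s n.+1 = s n + 1 by rewrite /s addSn natr1.
have s_nd n : s n <= s n.+1 by rewrite sS lerDl.
have AB_s n : A <= s n /\ B <= s n.
  have : Num.max `|A| `|B| <= s n.
    apply: (@le_trans _ _ (Num.bound (Num.max `|A| `|B|))%:R).
      by apply/ltW/archi_boundP; rewrite le_max normr_ge0.
    by rewrite ler_nat /n0 addnS -addSn addnA leq_addl.
  rewrite ge_max => /andP[As Bs].
  by split; [exact: le_trans (ler_norm A) As|exact: le_trans (ler_norm B) Bs].
have s_oo : s n @[n --> \oo] --> +oo.
  have := @cvgr_idn R; rewrite -(cvg_shiftn n0); exact.
have step f : (forall t, B <= t -> mono_from (derive1 f) t /\ MVT_from f t) ->
    forall n, derive1 f (s n.+1) <= f (s n.+1) - f (s n) <= derive1 f (s n).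
  move=> hf n; have [m1 /(_ _ (s_nd n))[c /andP[sc cs] ->]] := hf _ (AB_s n).2.
  have [mc _] := hf _ (le_trans (AB_s n).2 sc).
  have -> : s n.+1 - s n = 1 by rewrite sS addrAC subrr add0r.
  by rewrite mulr1 mc// m1.
have a_step := step a (fun t Bt => let: And4 _ _ m v := hB t Bt in conj m.1 v.1).
have W_step := step W (fun t Bt => let: And4 _ _ m v := hB t Bt in conj m.2 v.2).
have {}hB n := hB _ (AB_s n).2.
pose Z N := \sum_(n < N) derive1 W (s n).
(* Summing the unit-step bounds shows that [Z] and W along the samples differ by a bounded
   amount. *)
have W_le_Z N : W (s N) <= Z N + W (s 0).
  elim: N => [|N IH]; first by rewrite /Z big_ord0 add0r.
  rewrite /Z big_ord_recr/= -/(Z N); have := W_step N; lra.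
have Z_le_W N : Z N.+1 <= W (s N) + (derive1 W (s 0) - W (s 0)).
  elim: N => [|N IH]; first by rewrite /Z big_ord_recr/= big_ord0; lra.
  rewrite /Z big_ord_recr/= -/(Z N.+1); have := W_step N; lra.
have Z_ge0 N : 0 <= Z N.
  by apply: sumr_ge0 => n _; have [[_ _ _ /ltW]] := hB n.
have key : negligible_to Z
    (fun N => \sum_(n < N) derive1 W (s n) * (b (g (a (s n))) - L)).
  apply: (@weighted_cesaro_mean0 _ (derive1 W \o s) (a \o s) (r \o s)
    (* From r a <= (k+1) W and W <= Z + W(s 0), using Z + W(s 0) <= (W(s 0) + 1) (Z + 1). *)
    (k.+1%:R * (W (s 0) + 1)) _ _ _ _ _ _ _ _ _ _ _ _ _
    (fun j => b j - L) (fun n => g (a (s n))) (M + `|L|)) => //=.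
  - by move=> n; have [[_ _ _ /ltW]] := hB n.
  - by move=> n; have := W_step n; have := W_step n.+1; lra.
  - by move=> n; have [[]] := hB n.
  - move=> n; have /andP[+ _] := a_step n; apply: le_trans.
    by have [[_ /ltW]] := hB n.+1.
  - move=> n; have /andP[_ /le_lt_trans] := a_step n; apply.
    by have [[]] := hB n.
  - apply: (@squeeze_cvgr _ _ _ _ (fun=> 0) (derive1 a \o s)).
    + near=> n; have /andP[h1 ->] := a_step n; rewrite andbT (le_trans _ h1)//.
      by have [[_ /ltW]] := hB n.+1.
    + exact: cvg_cst.
    + exact: cvg_comp s_oo hardy_sublinear_derive1_cvg0.
  - exact: cvg_comp s_oo a_oo.
  - by move=> n; have [[_ /ltW a0 _ /ltW w0 _] _ _ _] := hB n; exact: divr_ge0.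
  - by case: r_mono => rm; [left|right] => n; apply: rm => //; have [] := AB_s n.
  - move=> n; have [[_ a0 _ /ltW w0 _] _ _ _] := hB n.
    rewrite /r mulrAC ler_pdivrMr// ler_wpM2l//.
    by have /andP[] := a_step n.
  - move=> n; have [[_ a0 _ /ltW w0 _] _ _ _] := hB n.+1.
    rewrite /r mulrAC ler_pdivlMr// ler_wpM2l//.
    by have /andP[] := a_step n.
  - by rewrite mulr_gt0// ltr_wpDl//; have [[_ _ _ _ /ltW]] := hB 0%N.
  - move=> n; have [[_ a0 _ w0 W0] ld _ _] := hB n; have [[_ _ _ _ W00] _ _ _] := hB 0%N.
    apply: (@le_trans _ _ (k.+1%:R * W (s n))).
      by rewrite /r mulrAC ler_pdivrMr// mulrC -mulrA [W _ * _]mulrC.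
    rewrite -mulrA ler_wpM2l//; have := W_le_Z n; have := Z_ge0 n.
    rewrite -/(Z n); nra.
  - move=> n; apply: g_nd; first by have [[]] := hB n.
    rewrite -subr_ge0; have /andP[+ _] := a_step n; apply: le_trans.
    by have [[_ /ltW]] := hB n.+1.
  - by move=> n; have [[/g_itv/andP[]]] := hB n.
  - by move=> n; have [[/g_itv/andP[]]] := hB n.
  - move=> j; apply: le_trans (ler_normB _ _) _; rewrite lerD2r//.
pose F n := derive1 W n%:R * y n.
have FE n : F (n + n0)%N = derive1 W (s n) * b (g (a (s n))).
  by rewrite /F yE//= /n0 addnS -addSn addnCA leq_addr.
(* The unnormalized error. It equals the negligible sum of [key], taken at [N.+1] because the term
   at [s N] is included, plus bounded terms. *)
pose D N := \sum_(1 <= n < (N + n0).+1) F n - L * W (s N).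
have D_neg : negligible_to (fun N => Z N.+1) D.
  pose S N := \sum_(n < N) derive1 W (s n) * (b (g (a (s n))) - L).
  apply: (@negligible_to_eq _ _ _ (fun N => (\sum_(1 <= n < n0) F n +
      L * (Z N.+1 - W (s N))) + S N.+1)).
    move=> N; rewrite /D (@big_cat_nat _ _ _ n0)//=; last first.
      by rewrite -addSn leq_addl.
    rewrite -{2}[n0]add0n big_addn -addSn addnK big_mkord.
    have -> : S N.+1 = \sum_(n < N.+1) F (n + n0)%N - L * Z N.+1.
      rewrite /S /Z mulr_sumr -sumrB; apply: eq_bigr => n _.
      by rewrite FE mulrBr [L * _]mulrC.
    ring.
  apply: negligible_toD; last by move=> e /key[C hC]; exists C => N; exact: hC.
  apply: (@negligible_to_bounded _ _ _ (`|\sum_(1 <= n < n0) F n| +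
     `|L| * (`|derive1 W (s 0)| + `|W (s 0)|))) => // N.
  apply: le_trans (ler_normD _ _) _; rewrite lerD2l normrM ler_wpM2l// ler_norml.
  have := Z_le_W N; have := W_le_Z N; have [[_ _ _ w0 _] _ _ _] := hB N.
  have := ler_norm (derive1 W (s 0)); have := ler_norm (- W (s 0)).
  have ZS : Z N.+1 = Z N + derive1 W (s N) by rewrite /Z big_ord_recr.
  have := ler_norm (W (s 0)); rewrite normrN ZS.
  have := normr_ge0 (derive1 W (s 0)); lra.
rewrite -(cvg_shiftn n0)/=.
have Ws_oo : W (s N) @[N --> \oo] --> +oo by exact: cvg_comp s_oo W_oo.
have D0 : D N / W (s N) @[N --> \oo] --> 0.
  apply: (negligible_to_cvg0 D_neg _ Ws_oo).
  by exists (derive1 W (s 0) - W (s 0)).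
rewrite (_ : (fun n => _) = (fun N => L + D N / W (s N))).
  by rewrite -{2}[L]addr0; apply: cvgD D0; exact: cvg_cst.
apply/funext => N; rewrite /D -/(s N) -/F mulrBl mulfK; last first.
  by have [[_ _ _ _ W0] _ _ _] := hB N; rewrite gt_eqF.
by rewrite addrC subrK mulrC.
Unshelve. all: by end_near. Qed.

End HardyField.

(** Zorn's lemma is applied to the sets whose union with [H] is a Hardy field, so that the empty
    chain, with union [H], needs no separate treatment. *)
Lemma hardy_field_sub_maximal {R : realType} (H : set (R -> R)) :
  hardy_field H -> exists2 K, maximal_hardy_field K & H `<=` K.
Proof.
move=> HH.
have [F F_sub F_total|K [HK K_max]] :=
    @Zorn_bigcup (R -> R) (fun K => hardy_field (K `|` H)).
  set G := \bigcup_(K in F) K `|` H.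
  (* Each field axiom involves at most two given elements, and these already lie in one Hardy field
     inside the union. *)
  have common f g : G f -> G g ->
      exists L, [/\ hardy_field L, L `<=` G, L f & L g].
    have sub K : F K -> K `|` H `<=` G.
      by move=> FK; apply: setSU; exact: bigcup_sup.
    move=> [[K FK Kf]|Hf] [[K' FK' K'g]|Hg].
    - have [KK'|K'K] := F_total _ _ FK FK'.
      + by exists (K' `|` H); split; [exact: F_sub|exact: sub|left; exact: KK'|left].
      + by exists (K `|` H); split; [exact: F_sub|exact: sub|left|left; exact: K'K].
    - by exists (K `|` H); split; [exact: F_sub|exact: sub|left|right].
    - by exists (K' `|` H); split; [exact: F_sub|exact: sub|right|left].
    - by exists H; split => //; exact: subsetUr.
  split.
  - by move=> f Gf; have [L [HL _ Lf _]] := common f f Gf Gf; exact: (hardy_cont HL).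
  - move=> f g Gf fg; have [L [HL LG Lf _]] := common f f Gf Gf.
    by apply: LG; exact: (hardy_germ HL Lf).
  - by right; exact: hardy1.
  - move=> f g Gf Gg; have [L [HL LG Lf Lg]] := common f g Gf Gg.
    by apply: LG; exact: (hardyB HL).
  - move=> f g Gf Gg; have [L [HL LG Lf Lg]] := common f g Gf Gg.
    by apply: LG; exact: (hardyM HL).
  - move=> f Gf nf0; have [L [HL LG Lf _]] := common f f Gf Gf.
    by have [g Lg fg] := hardyV HL Lf nf0; exists g => //; exact: LG.
  - by move=> f Gf; have [L [HL _ Lf _]] := common f f Gf Gf; exact: (hardy_derivable HL).
  - move=> f Gf; have [L [HL LG Lf _]] := common f f Gf Gf.
    by apply: LG; exact: (hardy_deriv HL).
exists (K `|` H); last exact: subsetUr.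
split=> // L HL KHL; apply/seteqP; split=> // f Lf; left.
apply: contrapT => Kf.
have LH : L `|` H = L.
  by apply/setUidPl; apply: subset_trans KHL; exact: subsetUr.
apply: (K_max L); last by rewrite LH.
split; first by apply: subset_trans KHL; exact: subsetUl.
by move=> LK; apply: Kf; exact: LK.
Qed.

(** * Cesaro hypotheses and integer parts for both signs *)

Lemma cesaro_negligible_succ {R : realType} (b : nat -> R) (L : R) :
  N%:R^-1 * (\sum_(1 <= n < N.+1) b n) @[N --> \oo] --> L ->
  negligible_to (fun j => j%:R : R) (fun N => \sum_(j < N) (b j.+1 - L)).
Proof.
move=> bL.
have x0 : N%:R^-1 * (\sum_(1 <= n < N.+1) b n) - L @[N --> \oo] --> L - L.
  by apply: cvgB bL _; exact: cvg_cst.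
rewrite subrr in x0.
apply: negligible_to_eq (negligible_to_mul_cvg0 _ x0) => // N.
rewrite big_add1/= big_mkord sumrB sumr_const card_ord.
have [->|N0] := posnP N; first by rewrite big_ord0 mulr0n mulr0 subrr.
have Nn0 : N%:R != 0 :> R by rewrite pnatr_eq0 -lt0n.
by rewrite mulrBl mulrAC mulVf// mul1r mulr_natr.
Qed.

(** Moving the index back from 1 to 0 costs only [b 0 - b N], which is bounded. *)
Lemma cesaro_negligible {R : realType} (b : nat -> R) (L M : R) :
  (forall j, `|b j| <= M) ->
  N%:R^-1 * (\sum_(1 <= n < N.+1) b n) @[N --> \oo] --> L ->
  negligible_to (fun j => j%:R : R) (fun N => \sum_(j < N) (b j - L)).
Proof.
move=> bM /cesaro_negligible_succ bL.
apply: (@negligible_to_eq _ _ _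
    (fun N => \sum_(j < N) (b j.+1 - L) + (b 0 - b N))).
  elim=> [|N IH]; first by rewrite !big_ord0 subrr addr0.
  by rewrite !big_ord_recr/= IH; ring.
apply: negligible_toD => //.
apply: (@negligible_to_bounded _ _ _ (M + M)) => // N.
by apply: le_trans (ler_normB _ _) _; rewrite lerD.
Qed.

Lemma absz_floor_itv {R : realType} (x : R) : 1 <= x ->
  (`|Num.floor x|%N)%:R <= x <= (`|Num.floor x|%N).+1%:R.
Proof.
move=> x1; have := floor_itv x.
have : 0 <= Num.floor x by rewrite floor_ge0 (le_trans _ x1).
case: (Num.floor x) => // n _; rewrite -natr1 /=.
by rewrite intrD => /andP[-> /ltW].
Qed.

Lemma absz_floor_nondecreasing {R : realType} (x y : R) : 1 <= x -> x <= y ->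
  (`|Num.floor x| <= `|Num.floor y|)%N.
Proof.
move=> x1 xy; have := le_floor xy.
have : 0 <= Num.floor x by rewrite floor_ge0 (le_trans _ x1).
by case: (Num.floor x) => // n _; case: (Num.floor y).
Qed.

(** [iterz] at [Negz j] iterates the inverse [j.+1] times, hence the predecessor here and the
    shifted sequence in [cesaro_negligible_succ]. *)
Lemma floorN_Negz {R : realType} (x : R) : 0 < x ->
  Num.floor (- x) = Negz (`|Num.floor (- x)|.-1)%N.
Proof.
move=> x0; have : Num.floor (- x) < 0 by rewrite floor_lt0 oppr_lt0.
by case: (Num.floor (- x)).
Qed.

Lemma absz_floorN_itv {R : realType} (x : R) : 1 <= x ->
  (`|Num.floor (- x)|.-1)%:R <= x <= (`|Num.floor (- x)|.-1).+1%:R.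
Proof.
move=> x1; have x0 : 0 < x by exact: lt_le_trans x1.
have := floor_itv (- x); rewrite (floorN_Negz x0); set j := _.-1 => /=.
rewrite NegzE intrD mulrNz -natr1; lra.
Qed.

Lemma absz_floorN_nondecreasing {R : realType} (x y : R) : 1 <= x -> x <= y ->
  (`|Num.floor (- x)|.-1 <= `|Num.floor (- y)|.-1)%N.
Proof.
move=> x1 xy; have x0 : 0 < x by exact: lt_le_trans x1.
have : Num.floor (- y) <= Num.floor (- x) by rewrite le_floor// lerN2.
rewrite (floorN_Negz x0) (floorN_Negz (lt_le_trans x0 xy)) /=.
by rewrite !NegzE lerN2.
Qed.

(** * Passage to almost every point *)

Theorem proposition1p20 (R : realType) (d : measure_display)
    (X : measurableType d) (mu : probability X R) (k : nat) (hk : (0 < k)%N)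
    (a W : R -> R) (c : R)
    (T : 'I_k -> X -> X) (nu : 'I_k -> probability X R)
    (aU : hardyU a)
    (a_oo : `|a t| @[t --> +oo] --> +oo)
    (a_sublinear : a t / t @[t --> +oo] --> (0 : R))
    (WE : hardyE W)
    (w_gt0 : \forall t \near +oo, 0 < derive1 W t)
    (w_noninc : exists A : R,
       forall s t : R, A <= s -> s <= t -> derive1 W t <= derive1 W s)
    (W_oo : W t @[t --> +oo] --> +oo)
    (c_gt0 : 0 < c)
    (W_le : \forall t \near +oo, W t <= `|a t| `^ c)
    (T_meas : forall i, measurable_fun [set: X] (T i))
    (nu_inv : forall i, invariant_measure (T i) (nu i))
    (nu_equiv : forall i, equivalent_measures (nu i) mu)
    (T_pje : pointwise_jointly_ergodic mu T nu)
    (a_neg : (\forall t \near +oo, a t < 0) ->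
       (forall i, invertible (T i)) /\
       pointwise_jointly_ergodic mu (fun i => inv_map (T i)) nu)
    (f : 'I_k -> X -> R)
    (f_meas : forall i, measurable_fun [set: X] (f i))
    (f_bounded : forall i, [bounded f i x | x in [set: X]]) :
  {ae mu, forall x,
    (W N%:R)^-1 * (\sum_(1 <= n < N.+1)
        derive1 W n%:R * \prod_(i < k) f i (iterz (T i) (Num.floor (a n%:R)) x))
      @[N --> \oo] -->
    \prod_(i < k) (\int[nu i]_(y in [set: X]) f i y)%R}.
Proof.
have [H HH Ha] := aU.
(* [a] is only known to lie in some Hardy field, while [W] lies in every maximal one; enlarging the
   former puts both in [K]. *)
have [K Kmax HK] := hardy_field_sub_maximal HH.
have [KH _] := Kmax.
have {HK}Ka := HK _ Ha; have KW := WE _ Kmax.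
(* The real exponent [c] can be raised to a natural number since [|a t|] is eventually at least
   1. *)
have W_leX : \forall t \near +oo, W t <= `|a t| ^+ Num.bound c.
  near=> t; apply: (@le_trans _ _ (`|a t| `^ c)); first by near: t.
  have a1 : 1 <= `|a t| by near: t; exact: (cvgryPge _).1.
  rewrite -powR_mulrn ?normr_ge0// ler_powR// ltW// archi_boundP// ltW//.
have f_bound i : exists M : R, forall x, `|f i x| <= M.
  by have [M _ hM] := pinfty_ex_gt (num_real 0) (f_bounded i); exists M => x; exact: hM.
pose M i := sval (cid (f_bound i)).
have fM i x : `|f i x| <= M i by exact: (svalP (cid (f_bound i))).
have prodM (S : 'I_k -> X) : `|\prod_(i < k) f i (S i)| <= \prod_(i < k) M i.
  by rewrite normr_prod; apply: ler_prod => i _; rewrite normr_ge0 fM.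
have [a0|a_gt0|a_lt0] := hardy_sign KH Ka.
- exfalso; near (pinfty_nbhs R) => t.
  have : 1 <= `|a t| by near: t; exact: (cvgryPge _).1.
  have -> : a t = 0 by near: t.
  by rewrite normr0 ler10.
- have a_pinfty : a t @[t --> +oo] --> +oo.
    apply: cvg_trans a_oo; apply: near_eq_cvg.
    by apply: filterS a_gt0 => t /gtr0_norm.
  have W_leX' : \forall t \near +oo, W t <= a t ^+ Num.bound c.
    by apply: filterS2 a_gt0 W_leX => t /gtr0_norm ->.
  apply: filterS (T_pje f f_meas f_bounded) => x hx.
  apply: (hardy_weighted_mean KH Ka KW a_pinfty a_sublinear w_gt0 w_noninc W_oo
    W_leX' absz_floor_nondecreasing absz_floor_itv
    (fun j => prodM (fun i => iter j (T i) x)) (cesaro_negligible _ hx)).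
    by move=> j; exact: prodM.
  have /cvgryPge/(_ 0) : a n%:R @[n --> \oo] --> +oo.
    by apply: cvg_comp a_pinfty; exact: cvgr_idn.
  apply: filterS => n an.
  apply: eq_bigr => i _; have : 0 <= Num.floor (a n%:R) by rewrite floor_ge0.
  by case: (Num.floor _).
(* For negative [a], the Cesaro means are those of the inverse maps, which [a_neg] provides. *)
have [_ Tinv_pje] := a_neg a_lt0.
pose a' t := - a t.
have Ka' : K a' := hardyN KH Ka.
have a'_pinfty : a' t @[t --> +oo] --> +oo.
  apply: cvg_trans a_oo; apply: near_eq_cvg.
  by apply: filterS a_lt0 => t /ltr0_norm.
have a'_sublinear : a' t / t @[t --> +oo] --> 0.
  rewrite -oppr0; under eq_fun do rewrite /a' mulNr.
  exact: cvgN.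
have W_leX' : \forall t \near +oo, W t <= a' t ^+ Num.bound c.
  by apply: filterS2 a_lt0 W_leX => t /ltr0_norm ->.
apply: filterS (Tinv_pje f f_meas f_bounded) => x hx.
apply: (hardy_weighted_mean KH Ka' KW a'_pinfty a'_sublinear w_gt0 w_noninc W_oo
  W_leX' absz_floorN_nondecreasing absz_floorN_itv
  (fun j => prodM (fun i => iter j.+1 (inv_map (T i)) x))
  (cesaro_negligible_succ hx)).
have /cvgryPgt/(_ 0) : a' n%:R @[n --> \oo] --> +oo.
  by apply: cvg_comp a'_pinfty; exact: cvgr_idn.
apply: filterS => n an.
by apply: eq_bigr => i _; rewrite -[a n%:R]opprK floorN_Negz.
Unshelve. all: by end_near. Qed.
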